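(* Let $X$ be a conditional set on the complete Boolean algebra $\mathcal{A}$. Then the collection $P(X)$ of all conditional subsets of $X$, partially ordered by conditional inclusion $\sqsubseteq$, is a complete Boolean algebra with least element $\mathbf{0}$ and greatest element $X$. Moreover, for conditional subsets $Y,Y^i\sqsubseteq X$, where $Y^i$ lives on $a_i$ for each $i$: (i) the supremum (conditional union) $\sqcup Y^i$ is the conditional subset living on $\bigvee a_i$ whose primal set is the stable set $$\Big\{\sum b_i y_i : (b_i)\in p(\textstyle\bigvee a_i),\ b_i\le a_i,\ y_i\in Y^i_{b_i}\text{ for all } i\Big\}$$ if the family is non-empty, and $\mathbf{0}$ otherwise; (ii) the infimum (conditional intersection) $\sqcap Y^i$ is the conditional subset living on $a_\ast:=\bigvee\{a\le \bigwedge a_i : \bigcap_i Y^i_a\neq\emptyset\}$ whose primal set is the stable set $\bigcap_i Y^i_{a_\ast}$ if the family is non-empty, and $X$ otherwise; (iii) the complement of $Y$ is $Y^{\sqsubset}:=\sqcup\{Z\sqsubseteq X : Y\sqcap Z=\mathbf{0}\}$.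
   Context: $\mathcal{A}$ is a complete Boolean algebra with $0\neq1$; $a\le b$ means $a\wedge b=a$, and $\mathcal{A}_b=\{a\in\mathcal{A}: a\le b\}$. For $a\in\mathcal{A}$, $p(a)$ is the set of families $(a_i)$ in $\mathcal{A}$ with $\bigvee a_i=a$ and $a_i\wedge a_j=0$ for $i\ne j$ (members equal to $0$ are allowed). A conditional set on $\mathcal{A}$ is $X=(X_a,\gamma_a)_{a\in\mathcal{A}}$, with sets $X_a$ and maps $\gamma_a:X_1\to X_a$, such that: $X_0$ is a singleton; each $\gamma_a$ is surjective; $\gamma_1$ is the identity; (consistency) $a\le b$ and $\gamma_b(x)=\gamma_b(y)$ imply $\gamma_a(x)=\gamma_a(y)$; (stability) for every $(a_i)\in p(1)$ and $(x_i)\in\prod_i X_{a_i}$ there is a unique $x\in X_1$ with $\gamma_{a_i}(x)=x_i$ for all $i$. For $a\le b$, $\gamma^b_a:X_b\to X_a$ denotes the induced map with $\gamma^b_a\circ\gamma_b=\gamma_a$, and $ax:=\gamma^b_a(x)$ for $x\in X_b$. For $(a_i)\in p(a)$ and $x_i\in X_{a_i}$, $\sum a_i x_i$ denotes the unique $x\in X_a$ with $a_ix=x_i$ for all $i$. The conditional empty set $\mathbf{0}$ is the unique conditional set on the one-element algebra $\{0\}$ (conditional sets differing only in their $0$-component are identified). A conditional set $Y=(Y_a,\delta_a)_{a\in\mathcal{B}}$ is a conditional subset of $X$, written $Y\sqsubseteq X$, if there is $b\in\mathcal{A}$ (we say $Y$ lives on $b$) with $\mathcal{B}=\mathcal{A}_b$,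 $Y_a\subseteq X_a$ and $\delta_a$ equal to the restriction of $\gamma^b_a$ to $Y_b$ for all $a\le b$; $\mathbf{0}$ is the conditional subset living on $0$. A non-empty $Y\subseteq X_b$ is stable if $\sum a_i(a_iy_i)\in Y$ for all $(a_i)\in p(b)$ and $(y_i)\subseteq Y$; stable subsets of $X_b$ correspond bijectively to conditional subsets living on $b$ (via their primal set $Y_b$). *)

(* Defs.v *)
From HB Require Import structures.
From mathcomp Require Import all_boot all_order all_classical.

Set Implicit Arguments.
Unset Strict Implicit.
Unset Printing Implicit Defensive.

Import Order.Theory.

Local Open Scope classical_set_scope.
Local Open Scope order_scope.

(* Every Boolean algebra is a [ctbDistrLatticeType]; note that this structure
   does not exclude [\bot = \top]. *)
Definition complete_lattice d (L : ctbDistrLatticeType d) : Prop :=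
  forall S : set L, supremums S !=set0.

(* The library's [supremum]/[infimum] take a default value, which is their
   value on the empty set; [\bot]/[\top] are the right choices there. *)
Definition Sup d (L : ctbDistrLatticeType d) (S : set L) : L := supremum \bot S.
Definition Inf d (L : ctbDistrLatticeType d) (S : set L) : L := infimum \top S.

Section ConditionalSets.
Context {d : Order.disp_t} {A : ctbDistrLatticeType d}.

(* (a_i) is in p(a) *)
Definition cpartition (a : A) (I : Type) (ai : I -> A) : Prop :=
  supremums (range ai) a /\ forall i j, i <> j -> ai i `&` ai j = \bot.

(* [is_cset T b X g]: the sets [X a] included in [T a], together with the maps
   [g a : X b -> X a], for [a] in the relative algebra [A_b], form a conditional
   set on [A_b] (whose greatest element is [b]).  Only indices below [b] are
   constrained. *)
Record is_cset (T : A -> Type) (b : A) (X : forall a, set (T a))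
    (g : forall a, T b -> T a) : Prop := IsCset {
  cset_bot : exists x, X \bot = [set x];
  cset_surj : forall a, a <= b -> g a @` X b = X a;
  cset_id : forall x, X b x -> g b x = x;
  cset_consistent : forall a c, a <= c -> c <= b ->
    forall x y, X b x -> X b y -> g c x = g c y -> g a x = g a y;
  cset_stable : forall (I : Type) (ai : I -> A), cpartition b ai ->
    forall xi : (forall i, T (ai i)), (forall i, X (ai i) (xi i)) ->
    exists! x, X b x /\ forall i, g (ai i) x = xi i
}.

Record cset := Cset {
  cset_sort :> A -> Type;
  gamma : forall a, cset_sort \top -> cset_sort a;
  csetP : is_cset (fun=> setT) gamma
}.

Variable X : cset.

Lemma gamma_surj a (x : X a) : exists z, gamma a z = x.
Proof.
have : [set: X a] x by [].
by rewrite -(cset_surj (csetP X) (lex1 a)) => -[z _ <-]; exists z.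
Qed.

(* gamma^b_a, so that [restr a x] is ax for x in X_b; meaningful for a <= b, where
   by consistency it does not depend on the chosen preimage of x under gamma_b. *)
Definition restr (b a : A) (x : X b) : X a := gamma a (sval (cid (gamma_surj x))).
Arguments restr {b} a x.

(* x in X_a is the sum of the a_i x_i, for (a_i) in p(a) and x_i in X_{a_i};
   such an x exists and is unique. *)
Definition is_csum (a : A) (I : Type) (ai : I -> A) (xi : forall i, X (ai i))
    (x : X a) : Prop := forall i, restr (ai i) x = xi i.

Definition stable (b : A) (S : set (X b)) : Prop :=
  S !=set0 /\
  forall (I : Type) (ai : I -> A) (y : I -> X b), cpartition b ai ->
    (forall i, S (y i)) ->
    forall x, is_csum (fun i => restr (ai i) (y i)) x -> S x.

(* A conditional subset living on b only has components Y_a with a <= b.  Setting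
   the other ones to the empty set makes equality of records the equality of
   conditional subsets.  The identification of conditional sets that differ in
   their 0-component is automatic, since Y_0 = X_0 is forced. *)
Unset Implicit Arguments.

Record csub := Csub {
  live : A;
  csub_sets :> forall a, set (X a);
  csub_out : forall a, ~~ (a <= live) -> csub_sets a = set0;
  csubP : is_cset csub_sets (fun a => @restr live a)
}.

Set Implicit Arguments.

Arguments Csub {live csub_sets}.

(* The maps of Y and of Z are restrictions of those of X, hence the maps of Y are
   automatically restrictions of those of Z. *)
Definition csubset (Y Z : csub) : Prop :=
  live Y <= live Z /\ forall a, a <= live Y -> Y a `<=` Z a.

Lemma restr_top : (fun a => @restr \top a) = @gamma X.
Proof.
apply/functional_extensionality_dep => a; apply/funext => x; rewrite /restr; case: cid => z /= <-.
by rewrite (cset_id (csetP X)).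
Qed.

Lemma cset_bot_eq a (x y : X a) : a = \bot -> x = y.
Proof.
move=> a0; move: x y; rewrite a0 => x y; have [z Xz] := cset_bot (csetP X).
have /= -> : [set z] x by rewrite -Xz.
by have /= -> : [set z] y by rewrite -Xz.
Qed.

Lemma cfull_out a : ~~ (a <= \top) -> [set: X a] = set0.
Proof. by rewrite lex1. Qed.

Lemma cfullP : is_cset (fun a => [set: X a]) (fun a => @restr \top a).
Proof. rewrite restr_top; exact: csetP. Qed.

Definition cfull : csub := Csub cfull_out cfullP.

Lemma cempty_out a : ~~ (a <= \bot) -> [set _ : X a | a = \bot] = set0.
Proof. by rewrite lex0 => /eqP a0; apply/seteqP; split. Qed.

Lemma cemptyP :
  is_cset (fun a => [set _ : X a | a = \bot]) (fun a => @restr \bot a).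
Proof.
have [x0 _] := cset_bot (csetP X).
split.
- by exists x0; apply/seteqP; split => // x _; exact: cset_bot_eq.
- move=> a; rewrite lex0 => /eqP a0; apply/seteqP; split => [//|x _].
  by exists x0 => //; exact: cset_bot_eq.
- by move=> x _; exact: cset_bot_eq.
- move=> a c ac; rewrite lex0 => /eqP c0 x y _ _ _; apply: cset_bot_eq.
  by apply/eqP; rewrite -lex0 -c0.
- move=> I ai [[ub _] _] xi _; exists x0; split; last first.
    by move=> x _; exact: cset_bot_eq.
  split=> // i; apply: cset_bot_eq.
  by apply/eqP; rewrite -lex0; apply: ub; exists i.
Qed.

Definition cempty : csub := Csub cempty_out cemptyP.

End ConditionalSets.

Arguments cset {d} A.
Arguments live {d A X}.
Arguments csub_sets {d A X}.
Arguments restr {d A X b} a x.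

Fact csub_display : Order.disp_t. Proof. exact: Order.Disp tt tt. Qed.

(* Main.v *)
(* View [X] as a sheaf on [A].  A conditional subset of [X] is determined by the
   set of its local sections, and the sets of local sections that arise in this
   way are exactly those closed under restriction and containing every section
   whose restrictions belonging to the set are dense: the regular open sets of
   the poset of local sections.  Conditional inclusion is inclusion, so infima
   are intersections, suprema are dense closures of unions, and the complement
   of [Y] consists of the sections having no non-trivial restriction in [Y].
   The explicit formulas come from exhaustion: a dense set of elements below
   [a] contains a partition of [a]. *)
From HB Require Import structures.
Require Import Defs.
From mathcomp Require Import all_boot all_order all_classical.

Set Implicit Arguments.
Unset Strict Implicit.
Unset Printing Implicit Defensive.

Import Order.Theory.

Local Open Scope classical_set_scope.
Local Open Scope order_scope.

#[local] Arguments csub_out {d A X} c a _.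
#[local] Arguments csubP {d A X} c.

(** * Suprema, partitions and exhaustion in a Boolean algebra *)

Section Suprema.
Context {d : Order.disp_t} {L : ctbDistrLatticeType d}.
Implicit Types (a b c e u : L) (S : set L).

Lemma supremums_Sup S a : supremums S a -> Sup S = a.
Proof.
move=> Sa; rewrite /Sup /supremum; case: ifPn => [/eqP S0|_].
  by apply/esym/eqP; rewrite -lex0; case: Sa => _; apply; rewrite S0.
case: xgetP => [b _ Sb|/(_ a)//].
by apply/le_anti/andP; split; [apply: Sb.2; exact: Sa.1|apply: Sa.2; exact: Sb.1].
Qed.

Lemma infimums_Inf S a : infimums S a -> Inf S = a.
Proof.
move=> Sa; rewrite /Inf /infimum; case: ifPn => [/eqP S0|_].
  by apply/esym/eqP; rewrite -le1x; case: Sa => _; apply; rewrite S0.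
case: xgetP => [b _ Sb|/(_ a)//].
by apply/le_anti/andP; split; [apply: Sa.2; exact: Sb.1|apply: Sb.2; exact: Sa.1].
Qed.

Lemma meet_compl0 a b : a `&` ~` b = \bot -> a <= b.
Proof. by move=> ab; rewrite -[a]meetx1 -(joinxC b) meetUr ab joinx0 leIr. Qed.

(** Otherwise the complement of [c] is an upper bound of [S], so [c] lies below its own
    complement. *)
Lemma supremums_meets S a c : supremums S a -> c <= a -> c <> \bot ->
  exists2 s, S s & c `&` s <> \bot.
Proof.
move=> [_ Sa] ca c0; apply: contrapT => cN; apply: c0.
have cS s : S s -> c `&` s = \bot.
  by move=> Ss; apply: contrapT => cs; apply: cN; exists s.
have aC : a <= ~` c.
  by apply: Sa => s Ss; rewrite -disj_leC meetC cS.
by apply/eqP; rewrite -[c]meetxx disj_leC (le_trans ca).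
Qed.

(** An upper bound [u] of the family lies above [a] because the part of [a] outside [u] is disjoint
    from every [ai i]. *)
Lemma cpartitionP a (I : Type) (ai : I -> L) :
  cpartition a ai <->
  [/\ forall i, ai i <= a, forall i j, i <> j -> ai i `&` ai j = \bot
    & forall c, c <= a -> (forall i, c `&` ai i = \bot) -> c = \bot].
Proof.
split=> [[aE aD]|[aU aD aM]].
  split=> [i|//|c ca cM]; first by apply: aE.1; exists i.
  apply: contrapT => /(supremums_meets aE ca)[_ [i _ <-]]; exact.
split=> //; split=> [_ [i _ <-]//|u uU]; apply: meet_compl0.
apply: aM => [|i]; first exact: leIl.
apply/eqP; rewrite -lex0 -(meetxC u) meetC leI2 ?leIr//.
by apply: uU; exists i.
Qed.

Lemma cpartition_meets a (I : Type) (ai : I -> L) c : cpartition a ai ->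
  c <= a -> c <> \bot -> exists i, c `&` ai i <> \bot.
Proof.
move=> /cpartitionP[_ _ aM] ca c0; apply: contrapT => cN; apply: c0.
by apply: aM => // i; apply: contrapT => ci; apply: cN; exists i.
Qed.

Lemma cpartition_unit a : cpartition a (fun _ : unit => a).
Proof.
by apply/cpartitionP; split=> // [[] []|c ca /(_ tt)]; rewrite ?(meet_l ca).
Qed.

(** Stability is assumed only over the top of a conditional set; this carries partitions of smaller
    elements there. *)
Lemma cpartition_extend a b (I : Type) (ai : I -> L) : a <= b -> cpartition a ai ->
  cpartition b (fun o : option I => if o is Some i then ai i else b `&` ~` a).
Proof.
move=> ab /cpartitionP[aU aD aM].
have aDC i : ai i `&` (b `&` ~` a) = \bot.
  by apply/eqP; rewrite -lex0 -(meetxC a) leI2 ?leIr.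
apply/cpartitionP; split=> [[i|]|[i|] [j|] // ij|c cb cM].
- exact: le_trans (aU i) ab.
- exact: leIl.
- by apply: aD => ij'; apply: ij; rewrite ij'.
- by rewrite meetC.
apply: aM => [|i]; last exact: (cM (Some i)).
by apply: meet_compl0; rewrite -(cM None) meetA (meet_l cb).
Qed.

(* Exhaustion: a maximal antichain of members of [P] below [a]. *)
Lemma dense_partition a (P : set L) :
  (forall c, c <= a -> c <> \bot -> exists e, [/\ e <= c, e <> \bot & P e]) ->
  exists2 Q : set L, Q `<=` P & cpartition a (fun q : set_type Q => val q).
Proof.
move=> Pdense.
pose antichain := [set Q : set L | [/\ Q `<=` P, (forall q, Q q -> q <= a)
  & forall p q, Q p -> Q q -> p <> q -> p `&` q = \bot]].
have [F Fac Ftot|Q [[QP Qa QD] Qmax]] := @Zorn_bigcup L antichain.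
  split=> [q [Q FQ]|q [Q FQ]|p q [Q FQ Qp] [R FR Rq]].
  - by have [+ _ _] := Fac _ FQ; apply.
  - by have [_ + _] := Fac _ FQ; apply.
  have [QR|RQ] := Ftot _ _ FQ FR.
    by have [_ _ +] := Fac _ FR; apply=> //; exact: QR.
  by have [_ _ +] := Fac _ FQ; apply=> //; exact: RQ.
exists Q => //; apply/cpartitionP; split=> [q|p q pq|c ca cQ].
- by apply: Qa; exact: set_valP.
- apply: QD; [exact: set_valP|exact: set_valP|].
  by move=> /val_inj.
(* A member [e] of [P] below [c] is disjoint from all of [Q], so adding it contradicts
   maximality. *)
apply: contrapT => /(Pdense c ca)[e [ec e0 Pe]].
have eQ q : Q q -> e `&` q = \bot.
  move=> Qq; apply/eqP; rewrite -lex0.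
  by rewrite -(cQ (SigSub (mem_set Qq))) leI2.
have Qe : ~ Q e by move=> /eQ; rewrite meetxx.
apply: (Qmax (e |` Q)).
  by split=> [q Qq|/(_ e (or_introl erefl))//]; right.
split=> [q [->//|/QP//]|q [->|/Qa//]|p q].
  exact: le_trans ca.
move=> [->|Qp] [->|Qq] // pq; [exact: eQ| |exact: QD].
by rewrite meetC eQ.
Qed.

End Suprema.

(** * Restriction and gluing of local sections *)

Section Restriction.
Context {d : Order.disp_t} {A : ctbDistrLatticeType d} {X : cset A}.
Implicit Types a b c : A.

Lemma restr_gamma a b z : a <= b -> restr a (gamma b z) = gamma a z :> X a.
Proof.
move=> ab; rewrite /restr; case: cid => w /= wz.
exact: (cset_consistent (csetP X) ab (lex1 b)).
Qed.

Lemma restr_restr a b c (x : X c) :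
  a <= b -> b <= c -> restr a (restr b x) = restr a x.
Proof.
move=> ab bc; have [z <-] := gamma_surj x.
by rewrite !restr_gamma// (le_trans ab).
Qed.

Lemma restr_id a (x : X a) : restr a x = x.
Proof. by have [z <-] := gamma_surj x; rewrite restr_gamma. Qed.

Lemma gamma_glue_top (I : Type) (ai : I -> A) (z : I -> X \top) :
  cpartition \top ai ->
  exists! w, forall i, gamma (ai i) w = gamma (ai i) (z i) :> X (ai i).
Proof.
move=> aP; have [//|w [[_ wE] wU]] := cset_stable (csetP X) aP
  (xi := fun i => gamma (ai i) (z i)).
by exists w; split=> // v vE; apply: wU.
Qed.

Lemma gamma_glue a (I : Type) (ai : I -> A) (z : I -> X \top) :
  cpartition a ai -> exists w, forall i, gamma (ai i) w = gamma (ai i) (z i) :> X (ai i).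
Proof.
(* Some global section is needed off [a]; the point of [X \bot] lifts to one. *)
move=> aP; have [z0 _] : exists z0 : X \top, True.
  have [x _] := cset_bot (csetP X); have [z0 _] := gamma_surj x; by exists z0.
have [w [wE _]] := gamma_glue_top (fun o => if o is Some i then z i else z0)
  (cpartition_extend (lex1 a) aP).
by exists w => i; exact: (wE (Some i)).
Qed.

(** Uniqueness in stability concerns global sections only. With lifts [z] of [x] and [t] of [y], the
    section [v] glued from [t] on [a] and [z] off [a] agrees with [z] on a partition of [\top],
    hence equals [z]. *)
Lemma restr_inj a (I : Type) (ai : I -> A) (x y : X a) : cpartition a ai ->
  (forall i, restr (ai i) x = restr (ai i) y) -> x = y.
Proof.
move=> aP; have [z <-] := gamma_surj x; have [t <-] := gamma_surj y => zt.
have /cpartitionP[aU _ _] := aP.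
have [v vE] := gamma_glue (fun o => if o is Some _ then t else z)
  (cpartition_extend (lex1 a) (cpartition_unit a)).
have [u [_ uU]] := gamma_glue_top (fun=> z) (cpartition_extend (lex1 a) aP).
rewrite -(vE (Some tt)) -(uU z) // (uU v) // => -[i|]; last exact: (vE None).
have := zt i; rewrite !restr_gamma// => ->.
by rewrite -(restr_gamma v (aU i)) (vE (Some tt)) restr_gamma.
Qed.

Lemma glue a (I : Type) (ai : I -> A) (z : forall i, X (ai i)) :
  cpartition a ai -> exists x : X a, forall i, restr (ai i) x = z i.
Proof.
move=> aP; have /cpartitionP[aU _ _] := aP.
have [t tE] := choice (fun i => gamma_surj (z i)).
have [w wE] := gamma_glue t aP; exists (gamma a w) => i.
by rewrite restr_gamma// wE.
Qed.

End Restriction.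

(** * Conditional subsets as dense-closed families of local sections *)

Section Subsheaves.
Context {d : Order.disp_t} {A : ctbDistrLatticeType d}.
Hypothesis Ac : complete_lattice A.
Variable X : cset A.
Implicit Types (a b c e : A) (Y Z : csub X).

Lemma SupP (S : set A) : supremums S (Sup S).
Proof. by have [a Sa] := Ac S; rewrite (supremums_Sup Sa). Qed.

Lemma le_Sup (S : set A) a : S a -> a <= Sup S.
Proof. by move=> Sa; apply: (SupP S).1. Qed.

(** Completeness is stated for suprema; an infimum is the supremum of the lower bounds. *)
Lemma InfP (S : set A) : infimums S (Inf S).
Proof.
suff Si : infimums S (Sup (lbound S)) by rewrite (infimums_Inf Si).
split=> [s Ss|b bS]; last exact: le_Sup.
by apply: (SupP _).2 => b; apply.
Qed.

(* Conditional subsets of [X] are the families below, through [csub_sets]: the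
   second condition is stability, with partitions replaced by dense families
   of restrictions. *)
Record subsheaf (D : forall a, set (X a)) : Prop := Subsheaf {
  subsheaf_restr : forall a b (x : X a), b <= a -> D a x -> D b (restr b x);
  subsheaf_dense : forall a (x : X a),
    (forall c, c <= a -> c <> \bot ->
      exists e, [/\ e <= c, e <> \bot & D e (restr e x)]) ->
    D a x
}.

(** A partition of [a] is dense: a non-zero [c] below [a] has a non-zero meet with some [ai i]. *)
Lemma subsheaf_glue D a (I : Type) (ai : I -> A) (x : X a) : subsheaf D ->
  cpartition a ai -> (forall i, D (ai i) (restr (ai i) x)) -> D a x.
Proof.
move=> Dsub aP Dx; apply: (subsheaf_dense Dsub) => c ca c0.
have /cpartitionP[aU _ _] := aP.
have [i ci] := cpartition_meets aP ca c0.
exists (c `&` ai i); split=> //; first exact: leIl.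
by rewrite -(restr_restr x (leIr _ _) (aU i)); apply: subsheaf_restr; rewrite ?leIr.
Qed.

Lemma subsheaf_bot D (x : X \bot) : subsheaf D -> D \bot x.
Proof.
by move=> Dsub; apply: subsheaf_dense => // c; rewrite lex0 => /eqP ->.
Qed.

Definition slive (D : forall a, set (X a)) : A := Sup [set a | D a !=set0].

Lemma slive_out D a : ~~ (a <= slive D) -> D a = set0.
Proof.
by move=> aD; apply/eqP/negPn/negP => /set0P Da; move/negP: aD; apply; exact: le_Sup.
Qed.

(** The supremum is attained: exhaustion partitions [slive D] by elements carrying sections of [D],
    and these sections glue. *)
Lemma slive_nonempty D : subsheaf D -> D (slive D) !=set0.
Proof.
move=> Dsub.
have [|Q QD QP] := @dense_partition _ _ (slive D) [set e | D e !=set0].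
  move=> c cD c0.
  have [s [x Dx] cs] := supremums_meets (SupP _) cD c0.
  exists (c `&` s); split=> //; first exact: leIl.
  by exists (restr (c `&` s) x); apply: subsheaf_restr; rewrite ?leIr.
pose z (q : set_type Q) := cid (QD _ (set_valP q)).
have [x xE] := glue (fun q => sval (z q)) QP.
by exists x; apply: (subsheaf_glue Dsub QP) => q; rewrite xE; exact: svalP (z q).
Qed.

Lemma subsheaf_is_cset D : subsheaf D -> is_cset D (fun a => @restr _ _ X (slive D) a).
Proof.
move=> Dsub; split.
- have [x _] := cset_bot (csetP X); exists x; apply/seteqP; split=> y _ /=.
    exact: cset_bot_eq.
  exact: subsheaf_bot.
- move=> a aD; apply/seteqP; split=> [_ [x Dx <-]|y Dy].
    exact: subsheaf_restr.
  (* To lift [y] from [a] to [slive D], a restriction of [y0] fills the remainder. *)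
  have aP := cpartition_extend aD (cpartition_unit a).
  have [y0 Dy0] := slive_nonempty Dsub.
  have [x xE] := glue (fun o : option unit =>
    match o return X (if o is Some _ then a else slive D `&` ~` a) with
    | Some _ => y | None => restr _ y0 end) aP.
  exists x; last exact: (xE (Some tt)).
  apply: (subsheaf_glue Dsub aP) => o; rewrite xE.
  by case: o => // ; apply: subsheaf_restr; rewrite ?leIl.
- by move=> x _; rewrite restr_id.
- by move=> a c ac cD x y _ _ xy; rewrite -(restr_restr x ac cD) xy restr_restr.
- move=> I ai aP xi Dxi; have [x xE] := glue xi aP; exists x; split.
    by split=> //; apply: (subsheaf_glue Dsub aP) => i; rewrite xE.
  by move=> y [_ yE]; apply: (restr_inj aP) => i; rewrite xE yE.
Qed.

Definition csub_of_subsheaf D (Dsub : subsheaf D) : csub X :=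
  @Csub d A X (slive D) D (@slive_out D) (subsheaf_is_cset Dsub).

Lemma csub_nonempty Y : Y (live Y) !=set0.
Proof.
have [x Yx] := cset_bot (csubP Y).
have : Y \bot x by rewrite Yx.
by rewrite -(cset_surj (csubP Y) (le0x _)) => -[y Yy _]; exists y.
Qed.

Lemma csub_le_live Y a (x : X a) : Y a x -> a <= live Y.
Proof. by move=> Yx; apply/negPn/negP => /(csub_out Y a) Y0; rewrite Y0 in Yx. Qed.

(** Exhaustion turns the density hypothesis into a partition of [a], to which stability of [Y]
    applies once it is extended to [live Y]. *)
Lemma csub_subsheaf Y : subsheaf Y.
Proof.
have Yrestr a b (x : X a) : b <= a -> Y a x -> Y b (restr b x).
  move=> ba Yx; have aY := csub_le_live Yx; have bY := le_trans ba aY.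
  move: Yx; rewrite -(cset_surj (csubP Y) aY) => -[y Yy <-].
  by rewrite restr_restr// -(cset_surj (csubP Y) bY); exists y.
split=> // a x xY.
have [|Q QY QP] := @dense_partition _ _ a [set e | e <= a /\ Y e (restr e x)].
  move=> c ca c0; have [e [ec e0 Ye]] := xY c ca c0.
  by exists e; split=> //; split=> //; exact: le_trans ca.
(* [Y a] is not yet known to be inhabited, but every piece of the partition lies below [live Y]. *)
have aY : a <= live Y.
  by apply: QP.1.2 => _ [q _ <-]; have [_ /csub_le_live] := QY _ (set_valP q).
have [y0 Yy0] := csub_nonempty Y.
have QP' := cpartition_extend aY QP.
have [|y [[Yy yE] _]] := cset_stable (csubP Y) QP'
    (xi := fun o : option (set_type Q) =>
    match o return X (if o is Some q then val q else live Y `&` ~` a) with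
    | Some q => restr _ x | None => restr _ y0 end).
  move=> [q|]; first by have [] := QY _ (set_valP q).
  by apply: Yrestr; rewrite ?leIl.
suff -> : x = restr a y by exact: Yrestr.
apply: (restr_inj QP) => q; have [qa _] := QY _ (set_valP q).
by rewrite restr_restr//; have /= -> := yE (Some q).
Qed.

(** Components off [live Y] are empty and the one at [live Y] is not, so componentwise inclusion
    also bounds [live Y]. *)
Lemma csubsetP Y Z : csubset Y Z <-> forall a, Y a `<=` Z a.
Proof.
split=> [[YZ sYZ] a x Yx|sYZ]; first exact: sYZ (csub_le_live Yx) _ Yx.
split=> // ; have [y /sYZ] := csub_nonempty Y; exact: csub_le_live.
Qed.

Lemma csub_ext Y Z : (forall a, Y a = Z a) -> Y = Z.
Proof.
move=> YZ; have lYZ : live Y = live Z.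
  have [y Yy] := csub_nonempty Y; have [z Zz] := csub_nonempty Z.
  apply/le_anti/andP; split.
    by apply: (@csub_le_live Z _ y); rewrite -YZ.
  by apply: (@csub_le_live Y _ z); rewrite YZ.
case: Y Z lYZ YZ => [a D Dout DP] [b E Eout EP] /= ab DE.
have {}DE : D = E by exact: functional_extensionality_dep.
by subst b E; congr Csub; exact: Prop_irrelevance.
Qed.

Lemma csub_anti Y Z : csubset Y Z -> csubset Z Y -> Y = Z.
Proof.
by move=> /csubsetP YZ /csubsetP ZY; apply: csub_ext => a; apply/seteqP.
Qed.

Lemma csub_stable Y : stable (Y (live Y)).
Proof.
split=> [|I ai y aP Yy x xE]; first exact: csub_nonempty.
apply: (subsheaf_glue (csub_subsheaf Y) aP) => i; rewrite xE.
by apply: (subsheaf_restr (csub_subsheaf Y)) => //; have /cpartitionP[] := aP.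
Qed.

Lemma subsheaf_inf (F : set (csub X)) :
  subsheaf (fun a => [set x | forall Y, F Y -> Y a x]).
Proof.
split=> [a b x ba Fx Y FY|a x xF Y FY].
  by apply: (subsheaf_restr (csub_subsheaf Y) ba); exact: Fx.
apply: (subsheaf_dense (csub_subsheaf Y)) => c ca c0.
by have [e [ec e0 Fe]] := xF c ca c0; exists e; split=> //; exact: Fe.
Qed.

Definition csub_inf F := csub_of_subsheaf (subsheaf_inf F).

Lemma subsheaf_sup (F : set (csub X)) :
  subsheaf (fun a => [set x : X a | forall c, c <= a -> c <> \bot ->
    exists e, [/\ e <= c, e <> \bot & exists2 Y : csub X, F Y & Y e (restr e x)]]).
Proof.
split=> [a b x ba xF c cb c0|a x xF c ca c0].
  have [e [ec e0 [Y FY Ye]]] := xF c (le_trans cb ba) c0.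
  by exists e; split=> //; exists Y => //; rewrite restr_restr// (le_trans ec).
(* Density is used twice: [e] comes from the hypothesis on [x], then [g] below [e] from membership
   in the closure at [e]. *)
have [e [ec e0 /(_ e (lexx e) e0)[g [ge g0 [Y FY Yg]]]]] := xF c ca c0.
exists g; split=> //; first exact: le_trans ec.
by exists Y => //; move: Yg; rewrite restr_restr// (le_trans ec).
Qed.

Definition csub_sup F := csub_of_subsheaf (subsheaf_sup F).

Lemma csub_sup_ub (F : set (csub X)) Y : F Y -> csubset Y (csub_sup F).
Proof.
move=> FY; apply/csubsetP => a x Yx c ca c0; exists c; split=> //.
by exists Y => //; exact: (subsheaf_restr (csub_subsheaf Y)).
Qed.

Lemma csub_sup_lub (F : set (csub X)) Z :
  (forall Y, F Y -> csubset Y Z) -> csubset (csub_sup F) Z.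
Proof.
move=> FZ; apply/csubsetP => a x xF.
apply: (subsheaf_dense (csub_subsheaf Z)) => c ca c0.
have [e [ec e0 [Y /FZ/csubsetP YZ Ye]]] := xF c ca c0.
by exists e; split=> //; exact: YZ.
Qed.

(** For density: below a non-trivial restriction of [x] in [Y] there would be a smaller non-trivial
    one, both in [Y] and in the candidate complement. *)
Lemma subsheaf_compl Y :
  subsheaf (fun a => [set x : X a | forall c, c <= a -> Y c (restr c x) -> c = \bot]).
Proof.
split=> [a b x ba xY c cb|a x xY c ca Yc].
  by rewrite restr_restr//; apply: xY; exact: le_trans ba.
apply: contrapT => c0; have [e [ec e0 /(_ e (lexx e))]] := xY c ca c0.
rewrite restr_id => eN; apply/e0/eN.
by rewrite -(restr_restr x ec ca); exact: (subsheaf_restr (csub_subsheaf Y)).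
Qed.

Definition csub_compl Y := csub_of_subsheaf (subsheaf_compl Y).

End Subsheaves.

(* The Boolean algebra operations depend on the completeness of [A]; the alias
   lets canonical structures carry that proof. *)
Definition csub_alg d (A : ctbDistrLatticeType d) (Ac : complete_lattice A)
  (X : cset A) : Type := csub X.

(** * The Boolean algebra of conditional subsets *)

Section Algebra.
Context {d : Order.disp_t} {A : ctbDistrLatticeType d}.
Variables (Ac : complete_lattice A) (X : cset A).
Local Notation P := (csub_alg Ac X).
Implicit Types Y Z W : P.

HB.instance Definition _ := gen_eqMixin P.
HB.instance Definition _ := gen_choiceMixin P.

Let le Y Z := `[< csubset Y Z >].
Let meet Y Z : P := csub_inf Ac [set Y; Z].
Let join Y Z : P := csub_sup Ac [set Y; Z].

Fact csub_le_refl : reflexive le.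
Proof. by move=> Y; apply/asboolP/csubsetP => a. Qed.

Fact csub_le_anti : antisymmetric le.
Proof. by move=> Y Z /andP[/asboolP YZ /asboolP ZY]; exact: csub_anti. Qed.

Fact csub_le_trans : transitive le.
Proof.
move=> Y Z W /asboolP/csubsetP ZY /asboolP/csubsetP YW.
by apply/asboolP/csubsetP => a; exact: subset_trans (YW a).
Qed.

HB.instance Definition _ :=
  Order.Le_isPOrder.Build csub_display P csub_le_refl csub_le_anti csub_le_trans.

Lemma csub_leP Y Z : reflect (csubset Y Z) (Y <= Z).
Proof. exact: asboolP. Qed.

Fact csub_meetP Y Z W : (Y <= meet Z W) = (Y <= Z) && (Y <= W).
Proof.
apply/idP/andP => [/csub_leP/csubsetP YZW|[/csub_leP/csubsetP YZ /csub_leP/csubsetP YW]].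
  by split; apply/csub_leP/csubsetP => a x /YZW; apply; [left|right].
by apply/csub_leP/csubsetP => a x Yx U [->|->]; [exact: YZ|exact: YW].
Qed.

Fact csub_joinP Y Z W : (join Y Z <= W) = (Y <= W) && (Z <= W).
Proof.
apply/idP/andP => [YZW|[/csub_leP YW /csub_leP ZW]].
  by split; apply: le_trans YZW; apply/csub_leP/csub_sup_ub; [left|right].
by apply/csub_leP/csub_sup_lub => U [->|->].
Qed.

HB.instance Definition _ := Order.POrder_MeetJoin_isLattice.Build csub_display P
  csub_meetP csub_joinP.

Lemma csub_joinE Y Z : Y `|` Z = csub_sup Ac [set Y; Z].
Proof. by []. Qed.

Lemma csub_meetE Y Z : csub_sets (Y `&` Z) = fun a => csub_sets Y a `&` csub_sets Z a.
Proof.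
apply: functional_extensionality_dep => a; apply/seteqP; split=> x.
  by rewrite /Order.meet /= => YZx; split; apply: YZx; [left|right].
by rewrite /Order.meet /= => -[Yx Zx] U [->|->].
Qed.

Fact csub_meetUl : left_distributive (@Order.meet _ P) Order.join.
Proof.
move=> Y Z W; apply/le_anti/andP; split; last first.
  by rewrite leUx !leI2 ?leUl ?leUr.
apply/csub_leP/csubsetP => a x; rewrite csub_meetE !csub_joinE => -[YZx Wx] c ca c0.
(* The restrictions of [x] that witness density in the join of [Y] and [Z] stay in [W], so they also
   witness it for the join of the meets. *)
have [e [ec e0 [U UYZ Ue]]] := YZx c ca c0; exists e; split=> //.
exists ((U : P) `&` W); first by case: UYZ => ->; [left|right].
rewrite csub_meetE; split=> //.
by apply: (subsheaf_restr (csub_subsheaf W)) => //; exact: le_trans ca.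
Qed.

HB.instance Definition _ := Order.Lattice_Meet_isDistrLattice.Build csub_display P
  csub_meetUl.

Fact csub_le0x Y : (cempty X : P) <= Y.
Proof.
apply/csub_leP/csubsetP => a x /= a0; subst a.
exact: subsheaf_bot (csub_subsheaf Y).
Qed.

Fact csub_lex1 Y : Y <= (cfull X : P).
Proof. exact/csub_leP/csubsetP. Qed.

HB.instance Definition _ := Order.hasBottom.Build csub_display P csub_le0x.
HB.instance Definition _ := Order.hasTop.Build csub_display P csub_lex1.

Let compl Y : P := csub_compl Ac Y.

(** Below [c], either some non-trivial restriction of [x] lies in [Y], or none does and the
    restriction to [c] lies in the complement. *)
Fact csub_joinxC Y : Y `|` compl Y = \top.
Proof.
apply/eqP; rewrite -le1x csub_joinE; apply/csub_leP/csubsetP => a x _ c ca c0.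
have [[e [ec e0 Ye]]|/forallNP cN] :=
    pselect (exists e, [/\ e <= c, e <> \bot & csub_sets Y e (restr e x)]).
  by exists e; split=> //; exists Y => //; left.
exists c; split=> //; exists (compl Y); first by right.
move=> e ec; rewrite restr_restr// => Ye; apply: contrapT => e0.
exact: (cN e).
Qed.

Fact csub_meetxC Y : Y `&` compl Y = \bot.
Proof.
apply/eqP; rewrite -lex0; apply/csub_leP/csubsetP => a x.
by rewrite csub_meetE => -[Yx /(_ a (lexx a))]; rewrite restr_id; apply.
Qed.

HB.instance Definition _ := Order.TBDistrLattice_hasComplement.Build csub_display P
  csub_joinxC csub_meetxC.

Lemma csub_supP (F : set P) : supremums F (csub_sup Ac F : P).
Proof.
split=> [Y FY|Z FZ]; first exact/csub_leP/csub_sup_ub.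
by apply/csub_leP/csub_sup_lub => Y /FZ/csub_leP.
Qed.

Lemma csub_infP (F : set P) : infimums F (csub_inf Ac F : P).
Proof.
split=> [Y FY|Z FZ]; apply/csub_leP/csubsetP => a x; first exact.
by move=> Zx Y /FZ/csub_leP/csubsetP; apply.
Qed.

Lemma csub_SupE (F : set P) : Sup F = csub_sup Ac F.
Proof. exact/supremums_Sup/csub_supP. Qed.

Lemma csub_InfE (F : set P) : Inf F = csub_inf Ac F.
Proof. exact/infimums_Inf/csub_infP. Qed.

(** A non-zero remainder of the left side outside the right side would contain, by density, a
    non-zero [e] over which some [Y] in [F] has a section, whence [e <= live Y]. *)
Lemma live_Sup (F : set P) : live (Sup F) = Sup [set live Y | Y in F].
Proof.
rewrite csub_SupE; apply/le_anti/andP; split; last first.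
  apply: (SupP Ac _).2 => _ [Y FY <-].
  by have /csub_leP[] := (csub_supP F).1 Y FY.
have [x xF] := csub_nonempty (csub_sup Ac F).
apply: meet_compl0; apply: contrapT => /(xF _ (leIl _ _))[e [ec + [Y FY Ye]]].
apply; apply/eqP; rewrite -lex0 -(meetxC (Sup [set live Z | Z in F])) lexI.
rewrite (le_trans ec (leIr _ _)) andbT (le_trans (csub_le_live Ye))//.
by apply: le_Sup => //; exists Y.
Qed.

(** Exhaustion yields a partition of [a] indexed by its own pieces, each carrying a section of some
    [Y i]; grouping the pieces by a choice of [i] indexes it by [I]. Conversely, a partition is
    dense. *)
Lemma Sup_partition (I : Type) (Y : I -> P) a (x : X a) :
  csub_sets (Sup (range Y)) a x <->
  exists2 b : I -> A, cpartition a b &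
    forall i, csub_sets (Y i) (b i) (restr (b i) x).
Proof.
rewrite csub_SupE; split=> [xY|[b bP Yb] c ca c0]; last first.
  have /cpartitionP[ba _ _] := bP.
  have [i ci] := cpartition_meets bP ca c0.
  exists (c `&` b i); split=> //; first exact: leIl.
  exists (Y i); first by exists i.
  rewrite -(restr_restr x (leIr _ _) (ba i)).
  by apply: (subsheaf_restr (csub_subsheaf _)); rewrite ?leIr.
have [|Q QY QP] := @dense_partition _ _ a
    [set e | e <= a /\ exists i, csub_sets (Y i) e (restr e x)].
  move=> c ca c0; have [e [ec e0 [_ [i _ <-] Ye]]] := xY c ca c0.
  by exists e; split=> //; split; [exact: le_trans ca|exists i].
have [k kY] := choice (fun q : set_type Q => (QY _ (set_valP q)).2).
have Qa q : Q q -> q <= a by move=> /QY[].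
have /cpartitionP[_ QD QM] := QP.
(* The join of the pieces assigned to [i], which is [\bot] when there are none. *)
pose b i := Sup [set val q | q in [set q : set_type Q | k q = i]].
have bmeet i c : c <= b i -> c <> \bot -> exists2 q, k q = i & c `&` val q <> \bot.
  by move=> cb /(supremums_meets (SupP Ac _) cb)[_ [q kq <-] cq]; exists q.
have ba i : b i <= a.
  by apply: (SupP Ac _).2 => _ [q _ <-]; exact: Qa (set_valP q).
exists b.
  apply/cpartitionP; split=> // [i j ij|c ca cM].
    (* A non-zero overlap of [b i] and [b j] would meet a piece assigned to [i], and inside it a
       piece assigned to [j]; distinct pieces are disjoint. *)
    apply: contrapT => /[dup] /(bmeet i _ (leIl _ _))[q qi bq] _.
    have [|r rj bqr] := bmeet j (b i `&` b j `&` val q) _ bq.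
      by rewrite -meetA leIxr// leIl.
    apply: bqr; rewrite -meetA QD ?meetx0// => qr.
    by apply: ij; rewrite -qi -rj qr.
  apply: QM => // q; apply/eqP; rewrite -lex0 -(cM (k q)) leI2//.
  by apply: (le_Sup Ac); exists q.
(* Over each piece assigned to [i] the section [x] lies in [Y i], and these pieces are dense below
   [b i]. *)
move=> i; apply: (subsheaf_dense (csub_subsheaf (Y i))) => c cb c0.
have [q qi cq] := bmeet i c cb c0.
exists (c `&` val q); split=> //; first exact: leIl.
rewrite restr_restr// ?(le_trans (leIl _ _) cb)//.
rewrite -(restr_restr x (leIr (val q) c) (Qa _ (set_valP q))) -qi.
by apply: (subsheaf_restr (csub_subsheaf _)); rewrite ?leIr.
Qed.

(** The type [X a] depends on [a], so the equation on [live Y] is eliminated here once, by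
    substitution. *)
Lemma stable_live Y a (S : set (X a)) : live Y = a -> csub_sets Y a = S -> stable S.
Proof. by move=> Ya <-; subst a; exact: csub_stable. Qed.

End Algebra.

Theorem theorem2p8 (d : Order.disp_t) (A : ctbDistrLatticeType d)
    (A_complete : complete_lattice A) (A_nontrivial : (\bot : A) <> \top)
    (X : cset A) :
  exists PX : Order.CTBDistrLattice.axioms_ csub_display (csub X),
  let P : ctbDistrLatticeType csub_display := Order.CTBDistrLattice.Pack PX in
  (forall Y Z : P, Y <= Z <-> csubset Y Z) /\
  complete_lattice P /\
  (\bot : P) = cempty X /\
  (\top : P) = cfull X /\
  (* (i) *)
  (forall (I : Type) (Y : I -> P),
    let a := Sup [set live (Y i) | i in [set: I]] in
    let U := [set x : X a | exists (b : I -> A) (y : forall i, X (b i)),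
      [/\ cpartition a b, forall i, b i <= live (Y i),
          forall i, csub_sets (Y i) (b i) (y i) & is_csum y x]] in
    (inhabited I ->
      [/\ live (Sup (range Y)) = a, stable U & csub_sets (Sup (range Y)) a = U]) /\
    (~ inhabited I -> Sup (range Y) = cempty X)) /\
  (* (ii) *)
  (forall (I : Type) (Y : I -> P),
    let a := Sup [set c : A | c <= Inf [set live (Y i) | i in [set: I]] /\
                              \bigcap_i csub_sets (Y i) c !=set0] in
    let U := \bigcap_i csub_sets (Y i) a in
    (inhabited I ->
      [/\ live (Inf (range Y)) = a, stable U & csub_sets (Inf (range Y)) a = U]) /\
    (~ inhabited I -> Inf (range Y) = cfull X)) /\
  (* (iii) *)
  (forall Y : P, ~` Y = Sup [set Z : P | Y `&` Z = cempty X]).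
Proof.
(* The class built on the alias also serves [csub X], the two types being convertible. *)
exists (Order.CTBDistrLattice.class (csub_alg A_complete X)).
move=> P; split; first by move=> Y Z; exact: iff_sym (rwP (csub_leP _ _)).
split; first by move=> F; exists (csub_sup A_complete F); exact: csub_supP.
do 2![split; first by []].
have range0 I (Y : I -> P) : ~ inhabited I -> range Y = set0.
  by move=> I0; rewrite -subset0 => Z [i _ _]; apply: I0.
split=> [I Y a U|]; last split=> [I Y a U|Y].
- split=> [_|/range0 ->]; last first.
    by apply: supremums_Sup; split=> // Z _; exact: le0x.
  have lE : live (Sup (range Y)) = a.
    rewrite live_Sup; congr (Sup _); apply/seteqP; split.
      by move=> _ [_ [i _ <-] <-]; exists i.
    by move=> _ [i _ <-]; exists (Y i) => //; exists i.
  have UE : csub_sets (Sup (range Y)) a = U.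
    apply/seteqP; split=> x.
      move=> /Sup_partition[b bP Yb]; exists b, (fun i => restr (b i) x).
      by split=> // i; exact: csub_le_live (Yb i).
    move=> [b [y [bP _ Yy xy]]]; apply/Sup_partition; exists b => // i.
    by rewrite xy.
  by split=> //; exact: stable_live lE UE.
- split=> [[i0]|/range0 ->]; last first.
    by apply: infimums_Inf; split=> // Z _; exact: lex1.
  have infE c : csub_sets (Inf (range Y)) c = \bigcap_i csub_sets (Y i) c.
    rewrite csub_InfE; apply/seteqP; split=> x Yx.
      by move=> i _; apply: Yx; exists i.
    by move=> _ [i _ <-]; exact: Yx.
  have lE : live (Inf (range Y)) = a.
    (* Being built from a subsheaf, the infimum lives on the supremum of the elements with an
       inhabited component. *)
    have -> : live (Inf (range Y)) = slive (csub_sets (Inf (range Y))).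
      by rewrite csub_InfE.
    congr (Sup _); apply/seteqP; split=> c /=; rewrite infE; last by case.
    (* The bound by the infimum is automatic: a section of [Y i] over [c] forces
       [c <= live (Y i)]. *)
    move=> Yc; split=> //; have [x Yx] := Yc.
    apply: (InfP A_complete _).2 => _ [i _ <-].
    exact: csub_le_live (Yx i Logic.I).
  by split=> //; apply: stable_live lE (infE _).
(* The complement of [Y] bounds the set from above and belongs to it. *)
- apply/esym/supremums_Sup; split=> [Z YZ|Z ZY].
    by rewrite -disj_leC meetC; apply/eqP.
  by apply: ZY; exact: meetxC.
Qed.
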